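(* The inconsistency index $K$ is not strongly upper bounded; that is, it is not true that $$K(\mathbf{A}^{\star})\le \sum_{h=1}^m\lambda_h\, K(\mathbf{A}_h)$$ for all $m\ge 2$, all pairwise comparison matrices $\mathbf{A}_1,\ldots,\mathbf{A}_m\in\mathcal{A}$ of the same order and all $\boldsymbol{\lambda}\in\mathcal{L}_m$.
   Context: A pairwise comparison matrix of order $n$ is a real $n\times n$ matrix $\mathbf{A}=(a_{ij})$ with $a_{ij}>0$ and $a_{ij}a_{ji}=1$ for all $i,j$. $\mathcal{A}$ is the set of all pairwise comparison matrices of all orders $n>2$. $\mathcal{L}_m=\{(\lambda_1,\ldots,\lambda_m): \lambda_h\ge 0\ \forall h,\ \sum_{h=1}^m\lambda_h=1\}$. Given $\mathbf{A}_h=(a_{ij}^{(h)})_{n\times n}\in\mathcal{A}$, $h=1,\ldots,m$ (same order $n$), and $\boldsymbol{\lambda}\in\mathcal{L}_m$, the aggregated matrix $\mathbf{A}^{\star}=(a_{ij}^{\star})_{n\times n}$ is $a_{ij}^{\star}=\prod_{h=1}^m (a_{ij}^{(h)})^{\lambda_h}$. For $\mathbf{A}\in\mathcal{A}$ of order $n$, $$K(\mathbf{A})=\max_{1\le i<j<k\le n}\ \min\left\{\left|1-a_{ij}a_{jk}a_{ki}\right|,\ \left|1-\frac{1}{a_{ij}a_{jk}a_{ki}}\right|\right\}.$$ *)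

(* Defs.v *)
From mathcomp Require Import all_boot all_order all_algebra.
From mathcomp Require Import reals exp.

Set Implicit Arguments.
Unset Strict Implicit.
Unset Printing Implicit Defensive.

Import Order.TTheory GRing.Theory Num.Theory.
Local Open Scope ring_scope.

Definition pairwise_comparison (R : realType) (n : nat) (A : 'M[R]_n) : Prop :=
  forall i j : 'I_n, 0 < A i j /\ A i j * A j i = 1.

Definition weight_vector (R : realType) (m : nat) (lambda : 'I_m -> R) : Prop :=
  (forall h, 0 <= lambda h) /\ \sum_(h < m) lambda h = 1.

Definition aggregate (R : realType) (n m : nat) (A : 'I_m -> 'M[R]_n)
    (lambda : 'I_m -> R) : 'M[R]_n :=
  \matrix_(i < n, j < n) \prod_(h < m) (A h i j `^ lambda h).

(* The terms are nonnegative and the index range is nonempty for n > 2, so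
   taking 0 as the default value of the iterated maximum does not affect it. *)
Definition K_index (R : realType) (n : nat) (A : 'M[R]_n) : R :=
  \big[Num.max/0]_(i < n) \big[Num.max/0]_(j < n | (i < j)%N)
    \big[Num.max/0]_(k < n | (j < k)%N)
      Num.min `|1 - A i j * A j k * A k i|
              `|1 - (A i j * A j k * A k i)^-1|.

(* Inconsistency indices are represented as functions on all square matrices;
   only their values on pairwise comparison matrices of order n > 2 matter
   (the aggregate of such matrices is again one). *)
Definition strongly_upper_bounded (R : realType)
    (I : forall n : nat, 'M[R]_n -> R) : Prop :=
  forall (n m : nat) (A : 'I_m -> 'M[R]_n) (lambda : 'I_m -> R),
    (2 < n)%N -> (2 <= m)%N ->
    (forall h, pairwise_comparison (A h)) ->
    weight_vector lambda ->
    I n (aggregate A lambda) <= \sum_(h < m) lambda h * I n (A h).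

(* Main.v *)
Require Import Defs.
From mathcomp Require Import all_boot all_order all_algebra.
From mathcomp Require Import reals exp.
From mathcomp Require Import lra zify.

(** For a matrix of order 3 with triple product [t = expR x], [K] equals
    [1 - expR (- `|x|)], which is strictly concave in [x] on the half-line
    [x >= 0], while aggregation averages [x].  Averaging a consistent matrix
    ([t = 1]) with one having [t = 4] gives [t = 2] and
    [K = 1/2 > 3/8 = (0 + 3/4) / 2]. *)

Set Implicit Arguments.
Unset Strict Implicit.
Unset Printing Implicit Defensive.

Import Order.TTheory GRing.Theory Num.Theory.
Local Open Scope ring_scope.

(** Order 3 admits a single increasing triple, so the maximum has only one genuine term. *)
Lemma K_index3 (R : realType) (A : 'M[R]_3) (i j k : 'I_3) :
  (i < j)%N -> (j < k)%N ->
  K_index A = Num.min `|1 - A i j * A j k * A k i|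
                      `|1 - (A i j * A j k * A k i)^-1|.
Proof.
move=> ij jk.
have k3 := ltn_ord k.
(* The chain [i < j < k < 3] forces the values 0, 1, 2. *)
have -> : i = ord0 by apply/val_inj => /=; lia.
have -> : j = lift ord0 ord0 by apply/val_inj => /=; rewrite /bump /=; lia.
have -> : k = lift ord0 (lift ord0 ord0).
  by apply/val_inj => /=; rewrite /bump /=; lia.
have enum3 : index_enum 'I_3 =
    [:: ord0; lift ord0 ord0; lift ord0 (lift ord0 ord0)].
  by rewrite [LHS]unlock -enumT !enum_ordSl (size0nil (size_enum_ord 0)).
rewrite /K_index enum3 !big_cons !big_nil /= /bump /=.
rewrite !maxxx.
(* What remains are maxima with the default 0 of exhausted ranges, absorbed because the term is
   nonnegative. *)
by rewrite max_l ?max_l // ?le_max ?le_min ?normr_ge0.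
Qed.

(** A one-parameter family realizing any triple product [t]: the whole inconsistency sits in one
    reciprocal pair of entries. *)
Definition corner_mx (R : realType) (t : R) : 'M[R]_3 :=
  \matrix_(i, j) if (i == ord0) && (j == ord_max) then t^-1
                 else if (i == ord_max) && (j == ord0) then t else 1.

Lemma corner_mx_pairwise_comparison (R : realType) (t : R) :
  0 < t -> pairwise_comparison (corner_mx t).
Proof.
move=> t0 i j; rewrite !mxE.
have tu : t \is a GRing.unit by rewrite unitfE gt_eqF.
by case: i => [[|[|[|//]]] ?]; case: j => [[|[|[|//]]] ?] /=;
  rewrite ?invr_gt0 ?mulr1 ?mulVr ?mulrV ?ltr01.
Qed.

Lemma K_index_corner_mx (R : realType) (t : R) :
  K_index (corner_mx t) = Num.min `|1 - t| `|1 - t^-1|.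
Proof.
by rewrite (@K_index3 _ _ ord0 (inord 1) ord_max) ?inordK // !mxE /=
  -!val_eqE /= !inordK //= !mul1r.
Qed.

(** The family is closed under aggregation, which thus reduces to a weighted geometric mean of the
    parameters. *)
Lemma aggregate_corner_mx (R : realType) (m : nat) (t lambda : 'I_m -> R) :
  (forall h, 0 <= t h) ->
  aggregate (fun h => corner_mx (t h)) lambda =
  corner_mx (\prod_(h < m) t h `^ lambda h).
Proof.
move=> t0; apply/matrixP => i j; rewrite !mxE -prodfV.
case: ifP => ij; [|case: ifP => ij'].
(* Inversion is the power [-1], so it commutes with the power [lambda h]. *)
- by apply: eq_bigr => h _; rewrite mxE ij -powRN -powR_inv1 // -powRrM mulN1r.
- by apply: eq_bigr => h _; rewrite mxE ij ij'.
- by apply: big1 => h _; rewrite mxE ij ij' powR1.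
Qed.

Theorem mainTheorem9 (R : realType) :
  ~ strongly_upper_bounded (fun n : nat => @K_index R n).
Proof.
(* Writing 4 as [2 ^+ 2] lets its square root be found by multiplying exponents. *)
pose t (h : 'I_2) : R := if h == ord0 then 1 else 2 ^+ 2.
have t0 h : 0 < t h by rewrite /t; case: ifP => _; rewrite ?exprn_gt0.
pose lambda (_ : 'I_2) : R := 2^-1.
have wl : weight_vector lambda.
  by split=> [h|]; rewrite /lambda ?invr_ge0 // !big_ord_recl big_ord0; lra.
move=> /(_ 3 2 (fun h => corner_mx (t h)) lambda isT isT
           (fun h => corner_mx_pairwise_comparison (t0 h)) wl).
rewrite aggregate_corner_mx; last by move=> h; apply: ltW.
rewrite !big_ord_recl !big_ord0 !K_index_corner_mx /t /lambda /=.
rewrite powR1 -powR_mulrn // -powRrM mulfV ?pnatr_eq0 // powRr1 // mul1r mulr1.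
rewrite powR_mulrn // invr1 subrr normr0 minxx mulr0 add0r addr0.
rewrite (_ : 1 - 2 = -1 :> R) ?normrN1; last by lra.
rewrite (_ : 1 - 2^-1 = 2^-1 :> R); last by lra.
rewrite (_ : 1 - (2 ^+ 2)^-1 = 3 / 4 :> R); last by rewrite expr2; lra.
rewrite (@ger0_norm _ 2^-1) ?invr_ge0 // (@ger0_norm _ (3 / 4)); last by lra.
rewrite min_r; last by lra.
(* An upper bound on the second index suffices: the assumed inequality would give
   [1 / 2 <= 3 / 8]. *)
have : Num.min `|1 - 2 ^+ 2 : R| (3 / 4) <= 3 / 4 by rewrite ge_min lexx orbT.
lra.
Qed.
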